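(* Let $\alpha\in[0,1]$. Let $G_1$ be a $t_1$-regular graph of order $n_1$ and size $m_1$, and let $G_2$ be an arbitrary graph of order $n_2$. Then $$\begin{aligned}\phi_{A_{\alpha}(G_1 \dot{\vee}_T G_2)}(\nu) &=(\nu +2 -2\alpha -2\alpha t_1)^{m_1 -n_1}\, \phi_{A_{\alpha}(G_2)}(\nu- \alpha n_1)\\ &\quad\times \prod_{i=2}^{n_1}\Big(\nu^2 +\big(2-t_1-2\alpha -\alpha t_1 -\alpha n_2 -2\lambda_i(A_\alpha(G_1))\big)\nu -(1-\alpha)\big(t_1 -2\alpha t_1 +\lambda_i(A_\alpha(G_1))\big)\\ &\qquad\qquad +\big(\alpha t_1 +\alpha n_2 + \lambda_i(A_{\alpha}(G_1))\big)\big(t_1 -2+2\alpha + \lambda_i(A_{\alpha}(G_1))\big) \Big)\\ &\quad\times \Big( (\nu-t_1-\alpha t_1 -\alpha n_2)(\nu+2-2\alpha -2t_1) -2t_1(1-\alpha)^2 -n_1(1-\alpha)^2(\nu+2-2\alpha-2t_1)\, \Upsilon_{A_{\alpha}(G_2)}(\nu-\alpha n_1) \Big).\end{aligned}$$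
   Context: All graphs are finite, undirected and simple. For a graph $G$ with adjacency matrix $A(G)$ and diagonal degree matrix $D(G)$, put $A_\alpha(G)=\alpha D(G)+(1-\alpha)A(G)$. For an $n\times n$ matrix $M$, $\phi_M(\nu)=\det(\nu I_n-M)$, and for symmetric $M$ the eigenvalues are listed with multiplicity as $\lambda_1(M)\ge\lambda_2(M)\ge\cdots\ge\lambda_n(M)$. The $M$-coronal is the rational function $\Upsilon_M(\nu)=\mathbf 1_n^T(\nu I_n-M)^{-1}\mathbf 1_n$, where $\mathbf 1_n$ is the all-ones column vector. The identity is an identity of rational functions in $\nu$. The total graph $T(G)$ is obtained from $G$ (keeping all its vertices and edges) by adding one new vertex for every edge of $G$, making each new vertex adjacent to the two end vertices of the corresponding edge, and making two new vertices adjacent whenever their corresponding (distinct) edges share an endpoint in $G$. The $T$-vertex join $G_1\dot\vee_T G_2$ is obtained from the disjoint union of $T(G_1)$ and $G_2$ by joining each original vertex of $G_1$ in $T(G_1)$ to every vertex of $G_2$. *)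

(* Defs.v *)
From HB Require Import structures.
From mathcomp Require Import all_boot all_order all_algebra.
From mathcomp Require Import polyorder polyrcf.

Set Implicit Arguments.
Unset Strict Implicit.
Unset Printing Implicit Defensive.

Import Order.TTheory GRing.Theory Num.Theory.

Local Open Scope ring_scope.

Record sgraph := SGraph {
  vertex :> finType;
  adj : rel vertex;
  adj_sym : symmetric adj;
  adj_irrefl : irreflexive adj
}.

Section Graph.
Variable G : sgraph.

Definition degree (x : G) : nat := #|[set y | adj x y]|.

Definition regular (t : nat) : Prop := forall x : G, degree x = t.

Definition edge_set : {set {set G}} :=
  [set [set p.1; p.2] | p : G * G & adj p.1 p.2].

Definition edge : finType := {e : {set G} | e \in edge_set}.

(* inl x is an original vertex, inr e the vertex added for the edge e. *)
Definition total_adj (u v : G + edge) : bool :=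
  match u, v with
  | inl x, inl y => adj x y
  | inl x, inr e => x \in val e
  | inr e, inl x => x \in val e
  | inr e, inr f => (e != f) && (val e :&: val f != set0)
  end.

Lemma total_adj_sym : symmetric total_adj.
Proof.
case=> [x|e] [y|f] //=; first exact: adj_sym.
by rewrite eq_sym setIC.
Qed.

Lemma total_adj_irrefl : irreflexive total_adj.
Proof. by case=> [x|e] /=; rewrite ?adj_irrefl ?eqxx. Qed.

Definition total_graph : sgraph :=
  @SGraph (G + edge)%type total_adj total_adj_sym total_adj_irrefl.

End Graph.

Section TVertexJoin.
Variables G1 G2 : sgraph.

Definition original (a : total_graph G1) : bool :=
  if a is inl _ then true else false.

Definition tvjoin_adj (u v : total_graph G1 + G2) : bool :=
  match u, v with
  | inl a, inl b => adj a b
  | inr x, inr y => adj x y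
  | inl a, inr _ => original a
  | inr _, inl b => original b
  end.

Lemma tvjoin_adj_sym : symmetric tvjoin_adj.
Proof.
by case=> [a|x] [b|y] //; [exact: (@total_adj_sym G1) | exact: adj_sym].
Qed.

Lemma tvjoin_adj_irrefl : irreflexive tvjoin_adj.
Proof.
by case=> [a|x]; [exact: (@total_adj_irrefl G1) | exact: adj_irrefl].
Qed.

Definition tvertex_join : sgraph :=
  @SGraph (total_graph G1 + G2)%type tvjoin_adj tvjoin_adj_sym tvjoin_adj_irrefl.

End TVertexJoin.

Section GraphMatrices.
Variables (R : nzRingType) (G : sgraph).

Definition adj_mx : 'M[R]_#|G| :=
  \matrix_(i, j) (adj (enum_val i) (enum_val j))%:R.

Definition deg_mx : 'M[R]_#|G| :=
  diag_mx (\row_i (degree (enum_val i))%:R).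

Definition Aalpha (alpha : R) : 'M[R]_#|G| :=
  alpha *: deg_mx + (1 - alpha) *: adj_mx.

End GraphMatrices.

Arguments Aalpha {R} G alpha.

(* The roots of the characteristic polynomial that lie in R, repeated
   according to multiplicity and in nonincreasing order. *)
Definition eigvals (R : rcfType) (n : nat) (M : 'M[R]_n) : seq R :=
  sort >=%R
    (flatten [seq nseq (\mu_x (char_poly M)) x | x <- rootsR (char_poly M)]).

(* Indexed from 1, as in lambda_1 >= lambda_2 >= ... >= lambda_n. *)
Definition lambda (R : rcfType) (n : nat) (M : 'M[R]_n) (i : nat) : R :=
  nth 0 (eigvals M) i.-1.

Notation ratfun R := {fraction {poly R}}.

Definition ratC (R : idomainType) (c : R) : ratfun R := tofrac c%:P.

Definition ratX (R : idomainType) : ratfun R := tofrac 'X.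

(* The argument z is an arbitrary rational function, so that phi and Upsilon
   can be evaluated at nu as well as at a translate of nu. *)
Section PhiUpsilon.
Variables (R : idomainType) (n : nat) (M : 'M[R]_n).

Definition shifted_mx (z : ratfun R) : 'M[ratfun R]_n :=
  z%:M - map_mx (@ratC R) M.

Definition phi (z : ratfun R) : ratfun R := \det (shifted_mx z).

Definition coronal (z : ratfun R) : ratfun R :=
  ((const_mx 1 : 'cV[ratfun R]_n)^T *m invmx (shifted_mx z)
     *m (const_mx 1 : 'cV[ratfun R]_n)) 0 0.

End PhiUpsilon.

(* Main.v *)
(* Order the vertices of the join as V(G1), E(G1), V(G2).  With N the incidence
   matrix of G1, the edge-edge block of the adjacency matrix is N^T N - 2 and
   N N^T = A(G1) + t1, so Schur complements with respect to G2 and to E(G1),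
   together with det(w - Y X) w^n = w^m det(w - X Y), reduce the determinant to
   that of q(M) - c J, where M = A_alpha(G1), q is a quadratic polynomial over
   the rational functions and J is the all-ones matrix.  Since M is
   diagonalizable and M 1 = t1 1, this determinant is the product of the
   q(lambda_i), i >= 2, times q(t1) - c n1; and t1 is the largest eigenvalue of
   M because the entries of M are nonnegative when 0 <= alpha <= 1. *)
Require Import Defs.
From HB Require Import structures.
From mathcomp Require Import all_boot all_order all_algebra.
From mathcomp Require Import perm polyorder polyrcf complex ring.
Import Order.TTheory GRing.Theory Num.Theory.
Local Open Scope ring_scope.

Set Implicit Arguments.
Unset Strict Implicit.
Unset Printing Implicit Defensive.

(** * Eigenvalues of symmetric matrices *)

Lemma det_similar (F : fieldType) n (P A B : 'M[F]_n) :
  P \in unitmx -> P *m A = B *m P -> \det A = \det B.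
Proof.
rewrite unitmxE unitfE => P0 /(congr1 determinant).
by rewrite !det_mulmx [RHS]mulrC => /(mulfI P0).
Qed.

(** The spectral theorem over [R[i]] diagonalizes [A] by a unitary matrix with real spectrum; the
    similarity then descends to the real field. [P] is only claimed invertible, which is enough for
    determinants. *)
Lemma sym_diagonalizable (R : rcfType) n (A : 'M[R]_n) : A^T = A ->
  exists2 P, P \in unitmx & exists d, P *m A = diag_mx d *m P.
Proof.
move=> symA; pose toC := real_complex R; pose Ac := map_mx toC A.
have realC (x : R) : toC x \is Num.real by rewrite complex_real.
have Areal : Ac \is a mxOver Num.real by apply/mxOverP => i j; rewrite mxE.
have Asym : Ac \is symmetricmx.
  by apply/is_hermitianmxP; rewrite expr0 scale1r /Ac map_mx_id// map_trmx symA.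
have Aherm := realsym_hermsym Asym Areal.
have Dreal := hermitian_spectral_diag_real Aherm.
have eqA := orthomx_spectralP (hermitian_normalmx Aherm).
set U := spectralmx Ac in eqA; set d := spectral_diag Ac in Dreal eqA.
have Uunit : U \in unitmx := spectral_unit _.
have dReal : diag_mx d \is a mxOver Num.real.
  by apply/mxOverP => i j; rewrite mxE rpredMn //; apply/mxOverP.
(* Two real matrices that are similar over [R[i]] are similar through a real matrix. *)
case: (real_similar (A := Ac) (B := diag_mx d)) => //.
  exists U => //; apply/simmxP => //.
  by rewrite {1}eqA -mulmxA mulKVmx.
move=> P /andP[Preal Punit] /simmxP-/(_ Punit) simA.
have lift m1 m2 (X : 'M[R[i]]_(m1, m2)) : X \is a mxOver Num.real ->
    exists Y, X = map_mx toC Y.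
  move=> /mxOverP Xr; exists (map_mx (@complex.Re R) X).
  by apply/matrixP => i j; rewrite !mxE; apply/esym/RRe_real.
have [P' eqP] := lift _ _ _ Preal; have [d' eqd] := lift _ _ _ Dreal.
exists P'; first by rewrite -(map_unitmx toC) -eqP.
exists d'; apply: (@map_mx_inj _ _ toC).
by rewrite !map_mxM map_diag_mx -eqP -eqd.
Qed.

Lemma char_poly_similar_diag (F : fieldType) n (P A : 'M[F]_n) (d : 'rV_n) :
  P \in unitmx -> P *m A = diag_mx d *m P ->
  char_poly A = \prod_(x <- [seq d 0 i | i : 'I_n]) ('X - x%:P).
Proof.
move=> Pu eqPA; rewrite big_image /=.
have -> : char_poly A = char_poly (diag_mx d).
  rewrite /char_poly /char_poly_mx; set Pc := map_mx polyC P.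
  have eqc : Pc *m ('X%:M - map_mx polyC A) = ('X%:M - map_mx polyC (diag_mx d)) *m Pc.
    rewrite mulmxBl mulmxBr -!map_mxM eqPA; congr (_ - _).
    by rewrite scalar_mxC.
  have detPc : \det Pc \is a GRing.unit.
    by rewrite det_map_mx; apply: rmorph_unit; rewrite -unitmxE.
  have /(congr1 determinant) := eqc; rewrite !det_mulmx [RHS]mulrC.
  exact: (mulrI detPc).
rewrite char_poly_trig ?diag_mx_is_trig//.
by apply: eq_bigr => i _; rewrite !mxE eqxx mulr1n.
Qed.

Lemma mu_prod_XsubC (R : idomainType) (s : seq R) (x : R) :
  \mu_x (\prod_(y <- s) ('X - y%:P)) = count_mem x s.
Proof.
elim: s => [|y s IHs]; first by rewrite big_nil mu_polyC.
rewrite big_cons /= mu_mul ?IHs; last first.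
  by rewrite mulf_neq0 ?polyXsubC_eq0 // monic_neq0 ?monic_prod_XsubC.
congr (_ + _)%N; have [->|nyx] := eqVneq y x; first exact: mu_XsubC.
by rewrite muNroot // root_XsubC eq_sym.
Qed.

(** Both lists are compared by counting each value [a]: in [s] it occurs as often as its
    multiplicity as a root, and in [eigvals A] only the block of the root [a] contributes, with that
    same length. *)
Lemma eigvals_split (R : rcfType) n (A : 'M[R]_n) (s : seq R) :
  char_poly A = \prod_(x <- s) ('X - x%:P) -> perm_eq (eigvals A) s.
Proof.
move=> splitA; rewrite /eigvals perm_sort splitA; set p := \prod_(_ <- _) _.
have p0 : p != 0 by rewrite monic_neq0 ?monic_prod_XsubC.
apply/allP => a _ /=; apply/eqP; rewrite -[RHS]mu_prod_XsubC -/p.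
rewrite count_flatten -map_comp sumnE big_map.
rewrite (eq_bigr (fun x => if x == a then \mu_a p else 0)%N); last first.
  by move=> x _ /=; rewrite count_nseq /=; case: eqP => [->|]; rewrite ?mul1n.
rewrite -big_mkcond -big_filter /=.
have [ra|nra] := boolP (a \in rootsR p).
  by rewrite filter_pred1_uniq ?uniq_roots // big_seq1.
rewrite (_ : [seq _ <- _ | _] = [::]) ?big_nil; last first.
  by apply/eqP; rewrite -[_ == _]negbK -has_filter has_pred1.
rewrite muNroot //; apply: contra nra => pa0.
by rewrite -roots_on_rootsR //= inE pa0 in_itv.
Qed.

Lemma lambda_prod (R : rcfType) (K : comNzRingType) n (A : 'M[R]_n) (s : seq R) (F : R -> K) :
  (0 < n)%N -> perm_eq (eigvals A) s -> size s = n ->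
  \prod_(x <- s) F x = F (lambda A 1) * \prod_(2 <= i < n.+1) F (lambda A i).
Proof.
move=> n0 eqs sz; have szA : size (eigvals A) = n by rewrite (perm_size eqs).
rewrite -(perm_big _ eqs) (big_nth 0) szA big_ltn //.
(* [lambda] reads position [i.-1], so the range starting at 2 becomes positions starting at 1. *)
by rewrite [in RHS]big_add1 /=.
Qed.

Lemma lambda1_max (R : rcfType) n (A : 'M[R]_n) (s : seq R) (t : R) :
  perm_eq (eigvals A) s -> t \in s -> (forall x, x \in s -> x <= t) ->
  lambda A 1 = t.
Proof.
move=> eqs ts maxt; rewrite /lambda /=.
have t_eig : t \in eigvals A by rewrite (perm_mem eqs).
have srt : sorted >=%R (eigvals A) by apply: sort_sorted => x y; exact: le_total.
case E: (eigvals A) srt t_eig => [//|x l] /= srt t_eig.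
have xt : x <= t by apply: maxt; rewrite -(perm_mem eqs) E mem_head.
apply/eqP; rewrite eq_le xt /=; move: t_eig; rewrite inE => /orP[/eqP->//|tl].
suff /allP/(_ _ tl) : all (>=%R x) l by [].
by apply: order_path_min srt; apply: rev_trans; apply: le_trans.
Qed.

(** The all-ones vector is a right eigenvector for [t]. Its image under the invertible [P] has a
    nonzero coordinate [i], and that coordinate of [P A 1 = D P 1] forces [d 0 i = t]. *)
Lemma rowsum_eigenvalue (R : fieldType) n (P A : 'M[R]_n) (d : 'rV_n) (t : R) :
  (0 < n)%N -> P \in unitmx -> P *m A = diag_mx d *m P ->
  (forall i, \sum_j A i j = t) -> exists i, d 0 i = t.
Proof.
move=> n0 Pu eqPA rowA; pose one := const_mx 1 : 'cV[R]_n.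
have A1 : A *m one = t *: one.
  by apply/matrixP => i j; rewrite !mxE -(rowA i) mulr1; apply: eq_bigr => k _; rewrite mxE mulr1.
have [i Pi] : exists i, (P *m one) i 0 != 0.
  apply/existsP; rewrite -[[exists _, _]]negbK negb_exists; apply/negP => /forallP P0.
  have : P *m one = 0 by apply/colP => i; rewrite [RHS]mxE; apply/eqP; rewrite -[_ == _]negbK P0.
  move=> /(congr1 (mulmx (invmx P))); rewrite mulKmx // mulmx0.
  by move=> /colP/(_ (Ordinal n0)); rewrite !mxE => /eqP; rewrite oner_eq0.
exists i; have := congr1 (fun X => (X *m one) i 0) eqPA.
rewrite -!mulmxA A1 -scalemxAr mxE mul_diag_mx [RHS]mxE.
by move=> /(mulIf Pi).
Qed.

(** Row [i] of [P] is a left eigenvector for [d 0 i]. Reading the eigenvalue equation at its entry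
    [k] of largest absolute value bounds [d 0 i] by the sum of column [k], which is [t] by
    symmetry. *)
Lemma rowsum_eigenvalue_le (R : rcfType) n (P A : 'M[R]_n) (d : 'rV_n) (t : R) i :
  P \in unitmx -> P *m A = diag_mx d *m P -> A^T = A ->
  (forall i j, 0 <= A i j) -> (forall i, \sum_j A i j = t) -> d 0 i <= t.
Proof.
move=> Pu eqPA symA A0 rowA.
case: (arg_maxP (fun j => `|P i j|) (erefl : predT i)) => k _ kmax.
have Pk : 0 < `|P i k|.
  rewrite normr_gt0; apply: contraL Pu => /eqP Pk0; apply/negP => Pu.
  have : row i P = 0.
    apply/rowP => j; rewrite !mxE; apply/eqP; rewrite -normr_eq0 eq_le normr_ge0 andbT.
    by have := kmax j isT; rewrite Pk0 normr0.
  move=> /(congr1 (mulmx^~ (invmx P))); rewrite -row_mul mulmxV // mul0mx.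
  by move=> /rowP/(_ i); rewrite !mxE eqxx => /eqP; rewrite oner_eq0.
rewrite -(ler_pM2r Pk); apply: le_trans (_ : `|d 0 i * P i k| <= _).
  by rewrite normrM ler_wpM2r // ler_norm.
have := congr1 (fun X : 'M_n => X i k) eqPA; rewrite mul_diag_mx !mxE => <-.
apply: le_trans (ler_norm_sum _ _ _) _.
rewrite -(rowA k) mulr_suml; apply: ler_sum => j _.
have -> : A j k = A k j by rewrite -[in LHS]symA mxE.
by rewrite normrM (ger0_norm (A0 _ _)) mulrC ler_wpM2l //; apply: kmax.
Qed.

(** * Determinant identities *)

(** The two enumerations differ by a permutation acting on rows and columns alike, so its sign
    appears squared. *)
Lemma det_reindex (K : comNzRingType) (T : finType) n (g : 'I_n -> T) (f : T -> T -> K) :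
  bijective g ->
  \det (\matrix_(i, j) f (g i) (g j))
  = \det (\matrix_(i < #|T|, j < #|T|) f (enum_val i) (enum_val j)).
Proof.
move=> bijg; have eq_n : n = #|T| by rewrite -(bij_eq_card bijg) card_ord.
subst n; have s_inj : injective (enum_rank \o g).
  exact: inj_comp enum_rank_inj (bij_inj bijg).
pose s := perm s_inj; set A := RHS.
have -> : \matrix_(i, j) f (g i) (g j)
    = row_perm s (col_perm s (\matrix_(i, j) f (enum_val i) (enum_val j))).
  by apply/matrixP => i j; rewrite !mxE !permE /= !enum_rankK.
by rewrite row_permE col_permE !det_mulmx !det_perm odd_permV mulrCA -expr2 sqrr_sign mulr1.
Qed.

Lemma det_schur (K : fieldType) n m (A : 'M[K]_n) (B : 'M_(n, m)) (C : 'M_(m, n)) (D : 'M_m) :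
  D \in unitmx ->
  \det (block_mx A B C D) = \det (A - B *m invmx D *m C) * \det D.
Proof.
move=> Du; have := congr1 determinant (mulmx_block A B C D 1%:M 0 (- (invmx D *m C)) 1%:M).
rewrite det_mulmx det_lblock !det1 !mulr1 => ->.
rewrite !mulmx1 !mulmx0 !add0r !mulmxN !mulmxA mulmxV // mul1mx subrr.
by rewrite det_ublock.
Qed.

(** The determinant of one block matrix is obtained by clearing its lower left block, once from the
    right and once from the left; the factors [w ^+ n] and [w ^+ m] avoid any division by [w]. *)
Lemma det_sylvester (K : idomainType) n m (w : K) (X : 'M_(n, m)) (Y : 'M_(m, n)) :
  w ^+ n * \det (w%:M - Y *m X) = w ^+ m * \det (w%:M - X *m Y).
Proof.
set D := block_mx w%:M X Y 1%:M.
have detD : \det D = \det (w%:M - X *m Y).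
  have := congr1 determinant (mulmx_block w%:M X Y 1%:M 1%:M 0 (- Y) 1%:M).
  rewrite det_mulmx det_lblock !det1 !mulr1 => ->.
  by rewrite !mulmx1 !mul1mx !mulmx0 add0r !mulmxN subrr add0r det_ublock det1 mulr1.
have := congr1 determinant (mulmx_block 1%:M 0 (- Y) w%:M w%:M X Y 1%:M).
rewrite det_mulmx det_lblock det1 det_scalar mul1r detD => ->.
rewrite !mul1mx !mul0mx !addr0 !mulmx1 !mulNmx scalar_mxC addNr det_ublock.
by rewrite det_scalar [- _ + _]addrC.
Qed.

(** As [X] scales the all-ones vector by [p], it factors out of [X - const_mx c], leaving a rank one
    perturbation of the identity that [det_sylvester] reduces to a scalar. *)
Lemma det_sub_ones (K : fieldType) n (X : 'M[K]_n) (p c : K) :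
  p != 0 -> X *m (const_mx 1 : 'cV_n) = p *: const_mx 1 ->
  p * \det (X - const_mx c) = \det X * (p - c * n%:R).
Proof.
move=> p0 X1; pose u := const_mx 1 : 'cV[K]_n.
have -> : X - const_mx c = X *m (1%:M - (u *m ((c / p) *: u^T))).
  rewrite mulmxBr mulmx1 mulmxA X1 -scalemxAr -scalemxAl scalerA divfK //.
  by congr (_ - _); apply/matrixP => i j; rewrite !mxE big_ord1 !mxE !mulr1.
rewrite det_mulmx mulrCA; congr (_ * _).
have := det_sylvester 1 u ((c / p) *: u^T); rewrite !expr1n !mul1r => <-.
rewrite det_mx11 -scalemxAl !mxE eqxx mulrBr mulr1 mulrCA mulrA divfK //.
congr (_ - c * _); under eq_bigr do rewrite !mxE mulr1.
by rewrite sumr_const card_ord.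
Qed.

(** At a shifted matrix this is [coronal] by conversion; it permits a block computation over any
    field. *)
Definition coronal_of (K : fieldType) k (E : 'M[K]_k) : K :=
  ((const_mx 1 : 'cV[K]_k)^T *m invmx E *m (const_mx 1 : 'cV[K]_k)) 0 0.

(** A Schur complement eliminates [D] and [E]. Multiplying it by [S] removes [invmx D], and the
    extra [\det S] is exactly what Sylvester's identity exchanges for [\det D]. *)
Lemma det_join_block (K : fieldType) n m k (M : 'M[K]_n) (N : 'M_(n, m)) (E : 'M_k)
    (b p r t w : K) :
  let S := (w - r)%:M - M in
  let D := w%:M - b *: (N^T *m N) in
  b *: (N *m N^T) = M + r%:M ->
  M *m (const_mx 1 : 'cV_n) = t *: const_mx 1 ->
  D \in unitmx -> E \in unitmx ->
  w ^+ n * \det (block_mx (p%:M - M) (row_mx (- b *: N) (const_mx (- b)))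
                   (col_mx (- b *: N^T) (const_mx (- b))) (block_mx D 0 0 E))
  = w ^+ m * \det E *
    \det (S *m (p%:M - M) - b *: (M + r%:M)
          - const_mx (b ^+ 2 * coronal_of E * (w - r - t))).
Proof.
move=> S D NNt M1 Du Eu; pose one l := const_mx 1 : 'cV[K]_l.
have SE : S = w%:M - b *: (N *m N^T).
  by rewrite NNt opprD addrA addrAC -[X in X - M]raddfB.
(* This intertwining gives [S *m N *m invmx D = N], so [D] never has to be inverted explicitly. *)
have SN : S *m N = N *m D.
  by rewrite SE mulmxBl mulmxBr scalar_mxC -scalemxAl -scalemxAr mulmxA.
have detSD : w ^+ n * \det D = w ^+ m * \det S.
  by have := det_sylvester w (b *: N) N^T; rewrite -scalemxAr -scalemxAl -SE.
have DEu : block_mx D 0 0 E \in unitmx.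
  by rewrite unitmxE det_ublock unitrM -!unitmxE Du Eu.
have Jn c : const_mx c = c *: (one n *m (one n)^T).
  by apply/matrixP => i j; rewrite !mxE big_ord1 !mxE !mulr1.
have BE : const_mx (- b) *m invmx E *m const_mx (- b) = const_mx (b ^+ 2 * coronal_of E) :> 'M_n.
  have -> : const_mx (- b) = - b *: (one n *m (one k)^T) :> 'M_(n, k).
    by apply/matrixP => i j; rewrite !mxE big_ord1 !mxE !mulr1.
  have -> : const_mx (- b) = - b *: (one k *m (one n)^T) :> 'M_(k, n).
    by apply/matrixP => i j; rewrite !mxE big_ord1 !mxE !mulr1.
  rewrite Jn -!scalemxAl -!scalemxAr scalerA mulrNN -expr2 -[RHS]scalerA; congr (_ *: _).
  rewrite -!mulmxA (mulmxA (one k)^T) (mulmxA (_ *m _) (one k)).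
  rewrite [_ *m one k]mx11_scalar mul_scalar_mx -scalemxAr.
  by congr (_ *: _).
have Du0 : invmx (block_mx D 0 0 E) = block_mx (invmx D) 0 0 (invmx E).
  by rewrite invmx_block_diag.
(* Scalar bookkeeping: [a] is the determinant of the Schur complement, and [d], [e], [s] are those
   of [D], [E], [S]. *)
have assemble (a d e s x y z : K) : x * d = y * s -> s * a = z -> x * (a * (d * e)) = y * e * z.
  by move=> xd <-; ring: xd.
rewrite det_schur // det_ublock Du0; apply: assemble detSD _.
rewrite -det_mulmx; congr (\det _).
rewrite mul_row_block !mulmx0 addr0 add0r mul_row_col BE.
rewrite mulmxBr -addrA; congr (_ + _); rewrite mulmxDr opprD; congr (- _ - _).
  rewrite -!scalemxAl -!scalemxAr scalerA mulrNN -NNt scalerA !mulmxA SN.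
  by rewrite mulmxK.
rewrite Jn -scalemxAr mulmxA mulmxBl M1 mul_scalar_mx -scalerBl -scalemxAl scalerA.
by rewrite -Jn.
Qed.

(** [U] carries every polynomial in [M] to the same polynomial in [diag_mx d]. *)
Lemma det_quadratic_mx (K : fieldType) n (U M : 'M[K]_n) (d : 'rV_n) (b p r w : K) :
  U \in unitmx -> U *m M = diag_mx d *m U ->
  \det (((w - r)%:M - M) *m (p%:M - M) - b *: (M + r%:M))
  = \prod_i ((w - r - d 0 i) * (p - d 0 i) - b * (d 0 i + r)).
Proof.
move=> Uu UM; pose e := \row_i ((w - r - d 0 i) * (p - d 0 i) - b * (d 0 i + r)).
have -> : \prod_i ((w - r - d 0 i) * (p - d 0 i) - b * (d 0 i + r)) = \det (diag_mx e).
  by rewrite det_diag; apply: eq_bigr => i _; rewrite mxE.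
apply: (det_similar Uu).
have UB c : U *m (c%:M - M) = (c%:M - diag_mx d) *m U.
  by rewrite mulmxBl mulmxBr scalar_mxC UM.
rewrite mulmxBr mulmxA UB -mulmxA UB mulmxA -scalemxAr.
rewrite [U *m (M + _)]mulmxDr UM scalar_mxC -mulmxDl.
rewrite scalemxAl -mulmxBl; congr (_ *m _).
rewrite -!diag_const_mx -!raddfB -raddfD mulmx_diag -linearZ /= -raddfB.
by congr diag_mx; apply/rowP => i; rewrite !mxE.
Qed.

(** * Edges and degrees *)

Lemma degreeE (G : sgraph) (x : G) : degree x = (\sum_y adj x y)%N.
Proof.
by rewrite /degree -sum1dep_card big_mkcond; apply: eq_bigr => y _; case: adj.
Qed.

Section Incidence.
Variable G : sgraph.
Implicit Types (x y : G) (e f : edge G).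
Local Open Scope nat_scope.

Lemma edgeP e : exists x y, adj x y /\ val e = [set x; y].
Proof.
have /imsetP[[x y] xy eqe] := valP e; exists x, y; split; last exact: eqe.
by rewrite inE in xy.
Qed.

Lemma card_edge e : #|val e| = 2.
Proof.
have [x [y [xy ->]]] := edgeP e; rewrite cards2.
by case: eqVneq xy => // ->; rewrite adj_irrefl.
Qed.

Lemma sum_card (T : finType) (A : {set T}) : \sum_x (x \in A) = #|A|.
Proof. by rewrite -sum1_card [RHS]big_mkcond; apply: eq_bigr => x _; case: ifP. Qed.

Lemma sum_in_edge e : \sum_x (x \in val e) = 2.
Proof. by rewrite sum_card card_edge. Qed.

Lemma edge_between x y e : x != y -> x \in val e -> y \in val e -> val e = [set x; y].
Proof.
move=> xy xe ye; apply/esym/eqP; rewrite eqEcard cards2 xy card_edge leqnn andbT.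
by apply/subsetP => z; rewrite !inE => /orP[]/eqP->.
Qed.

Lemma adj_edge x y e : val e = [set x; y] -> adj x y.
Proof.
move=> eqe; have [a [b [ab eqab]]] := edgeP e; rewrite eqab in eqe.
have nab : a != b by apply: contraTneq ab => ->; rewrite adj_irrefl.
have /set2P[ax|ay] : a \in [set x; y] by rewrite -eqe set21.
  have /set2P[bx|by_] : b \in [set x; y] by rewrite -eqe set22.
    by rewrite ax bx eqxx in nab.
  by rewrite -ax -by_.
have /set2P[bx|by_] : b \in [set x; y] by rewrite -eqe set22.
  by rewrite -ay -bx adj_sym.
by rewrite ay by_ eqxx in nab.
Qed.

Lemma sum_edges_between x y : x != y ->
  \sum_(e : edge G) (x \in val e) * (y \in val e) = adj x y.
Proof.
move=> xy; have [axy|naxy] := boolP (adj x y); last first.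
  apply: big1 => e _; case: (boolP (x \in _)) => //= xe; case: (boolP (y \in _)) => //= ye.
  by rewrite (adj_edge (edge_between xy xe ye)) in naxy.
have xyE : [set x; y] \in edge_set G by apply/imsetP; exists (x, y); rewrite ?inE.
rewrite (bigD1 (Sub [set x; y] xyE : edge G)) //= set21 set22 big1 // => e ne.
case: (boolP (x \in _)) => //= xe; case: (boolP (y \in _)) => //= ye.
by case/eqP: ne; apply: val_inj; rewrite (edge_between xy xe ye).
Qed.

(* Counts the pairs (y, e) with y <> x and x, y both in e. *)
Lemma sum_edges_at x : \sum_(e : edge G) (x \in val e) = degree x.
Proof.
rewrite degreeE (bigD1 x) //= adj_irrefl add0n.
rewrite (eq_bigr (fun y => \sum_(e : edge G) (x \in val e) * (y \in val e))); last first.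
  by move=> y yx; rewrite sum_edges_between // eq_sym.
rewrite exchange_big; apply: eq_bigr => e _; rewrite -big_distrr /=.
case: (boolP (x \in _)) => //= xe.
by have := sum_in_edge e; rewrite (bigD1 x) //= xe mul1n add1n => -[->].
Qed.

(** Distinct edges share at most one vertex, since two common vertices determine the edge. This is
    the entrywise form of the identity for the Gram matrix of the incidence columns. *)
Lemma edge_capE e f :
  \sum_x (x \in val e) * (x \in val f)
  = 2 * (e == f) + ((e != f) && (val e :&: val f != set0)).
Proof.
transitivity #|val e :&: val f|.
  by rewrite -sum_card; apply: eq_bigr => x _; rewrite inE; do 2!case: (_ \in _).
have [->|ef] := eqVneq e f; first by rewrite setIid card_edge.
rewrite -card_gt0 /= muln0 add0n.
suff : #|val e :&: val f| < 2 by case: #|_| => [|[]].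
rewrite ltnNge; apply: contra ef => le2; apply/eqP/val_inj.
have eqI (g : edge G) : val e :&: val f \subset val g -> val e :&: val f = val g.
  by move=> sub; apply/eqP; rewrite eqEcard sub card_edge.
by rewrite -(eqI e (subsetIl _ _)) (eqI f (subsetIr _ _)).
Qed.

(** Exposes the vertex type as a sum type, so that [big_sumType] can split the degree. *)
Let degree_totalE (v : total_graph G) :
  degree v = \sum_(u : (G + edge G)%type) total_adj v u := degreeE v.

Lemma degree_total_vertex x : degree (inl x : total_graph G) = 2 * degree x.
Proof.
rewrite degree_totalE big_sumType /= sum_edges_at -degreeE.
by rewrite mul2n addnn.
Qed.

(** Count pairs of an end vertex of [e] and an edge through it: there are [2 * t]. The edge [e]
    itself is counted twice, which matches the two end vertices adjacent to it in the total
    graph. *)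
Lemma degree_total_edge t e : regular G t -> degree (inr e : total_graph G) = 2 * t.
Proof.
move=> regG; rewrite degree_totalE big_sumType /= sum_in_edge.
have : \sum_(f : edge G) \sum_x (x \in val e) * (x \in val f) = 2 * t.
  rewrite exchange_big /= -(sum_in_edge e) big_distrl; apply: eq_bigr => x _.
  by rewrite -big_distrr /= sum_edges_at regG.
under eq_bigr do rewrite edge_capE.
rewrite big_split /= -big_distrr /= (bigD1 e) //= eqxx big1 // => f fe.
by rewrite eq_sym (negPf fe).
Qed.

End Incidence.

Section JoinDegrees.
Variables G1 G2 : sgraph.

Let degree_joinE (v : tvertex_join G1 G2) :
  degree v = (\sum_(u : (total_graph G1 + G2)%type) tvjoin_adj v u)%N := degreeE v.

Lemma degree_join_left (a : total_graph G1) :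
  degree (inl a : tvertex_join G1 G2) = (degree a + original a * #|G2|)%N.
Proof.
by rewrite degree_joinE big_sumType /= -(degreeE a) sum_nat_const mulnC.
Qed.

Lemma degree_join_right (y : G2) :
  degree (inr y : tvertex_join G1 G2) = (degree y + #|G1|)%N.
Proof.
rewrite degree_joinE big_sumType /= -degreeE addnC; congr addn.
have -> : (\sum_(a : total_graph G1) original a
    = \sum_(a : (G1 + edge G1)%type) original (a : total_graph G1))%N by [].
by rewrite big_sumType /= sum1_card big1 ?addn0.
Qed.

End JoinDegrees.

Lemma eq_expfz_sub (K : fieldType) (w y z : K) (m n : nat) :
  w != 0 -> w ^+ n * y = w ^+ m * z -> y = w ^ (m%:Z - n%:Z) * z.
Proof.
move=> w0 eqyz; apply: (mulfI (expf_neq0 n w0)); rewrite eqyz mulrA.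
by congr (_ * _); rewrite !exprnP -expfzDr // addrC subrK.
Qed.

(** * The block matrix over the field of rational functions *)

HB.instance Definition _ (R : idomainType) :=
  GRing.RMorphism.copy (@ratC R) (@tofrac {poly R} \o polyC).

Section RatC.
Variable R : idomainType.
Local Notation c := (@ratC R).

Definition ratCE := (rmorphD c, rmorphN c, rmorphM c, rmorph_nat c, rmorph1 c, rmorphMn c).

End RatC.

Section RationalFunctions.
Variable R : fieldType.
Local Notation nu := (ratX R).

Lemma ratXsubC (c : R) : nu - ratC c = tofrac ('X - c%:P).
Proof. by rewrite rmorphB. Qed.

Lemma ratXsubC_neq0 (c : R) : nu - ratC c != 0.
Proof. by rewrite ratXsubC tofrac_eq0 polyXsubC_eq0. Qed.

(** A product of two monic linear polynomials has size 3, a constant at most 1. *)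
Lemma ratX_quadratic_neq0 (c1 c2 c3 : R) :
  (nu - ratC c1) * (nu - ratC c2) - ratC c3 != 0.
Proof.
rewrite !ratXsubC -rmorphM -rmorphB tofrac_eq0 subr_eq0.
apply/eqP => /(congr1 (fun p : {poly R} => size p)).
rewrite size_mul ?polyXsubC_eq0 // !size_XsubC /= => eq3.
by have := size_polyC_leq1 c3; rewrite -eq3.
Qed.

(** Translating the variable by [c] amounts to replacing [M] by [M + c%:M], whose characteristic
    polynomial is monic, hence nonzero. *)
Lemma shifted_mx_unit n (M : 'M[R]_n) (c : R) : shifted_mx M (nu - ratC c) \in unitmx.
Proof.
have -> : shifted_mx M (nu - ratC c) = map_mx (@tofrac {poly R}) (char_poly_mx (M + c%:M)).
  apply/matrixP => i j; rewrite !mxE rmorphB rmorphMn /= rmorphD /= polyCMn.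
  rewrite rmorphD /= rmorphMn /= mulrnBl opprD addrA addrAC; congr (_ - _).
rewrite unitmxE det_map_mx unitfE tofrac_eq0.
exact: monic_neq0 (char_poly_monic _).
Qed.

End RationalFunctions.

(** * Vertex ordering of the join *)

Section JoinIndex.
Variables G1 G2 : sgraph.
Local Notation E1 := (edge G1).

(** The nested sum of ordinals matches the layout of [block_mx], which the enumeration underlying
    [Aalpha] need not follow. *)
Definition join_index (i : 'I_(#|G1| + (#|E1| + #|G2|))) : tvertex_join G1 G2 :=
  match split i with
  | inl x => inl (inl (enum_val x))
  | inr j => match split j with
             | inl e => inl (inr (enum_val e))
             | inr y => inr (enum_val y)
             end
  end.

Lemma join_index_vertex x : join_index (lshift _ x) = inl (inl (enum_val x)).
Proof. by rewrite /join_index (unsplitK (inl x)). Qed.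

Lemma join_index_edge e : join_index (rshift _ (lshift _ e)) = inl (inr (enum_val e)).
Proof. by rewrite /join_index (unsplitK (inr _)) (unsplitK (inl e)). Qed.

Lemma join_index_right y : join_index (rshift _ (rshift _ y)) = inr (enum_val y).
Proof. by rewrite /join_index (unsplitK (inr _)) (unsplitK (inr y)). Qed.

Definition join_indexE := (join_index_vertex, join_index_edge, join_index_right).

Lemma join_index_bij : bijective join_index.
Proof.
pose rank (v : total_graph G1 + G2) : 'I_(#|G1| + (#|E1| + #|G2|)) :=
  match v with
  | inl (inl x) => lshift _ (enum_rank x)
  | inl (inr e) => rshift _ (lshift _ (enum_rank e))
  | inr y => rshift _ (rshift _ (enum_rank y))
  end.
exists rank => [i|]; last by case=> [[x|e]|y]; rewrite /rank join_indexE enum_rankK.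
case: (split_ordP i) => [x|j] ->; first by rewrite join_indexE /= enum_valK.
by case: (split_ordP j) => [e|y] ->; rewrite join_indexE /= enum_valK.
Qed.

End JoinIndex.

(** * Incidence matrix identities and the matrix [Aalpha] of a regular graph *)

Section Blocks.
Variables (R : nzRingType) (G : sgraph).

Definition incidence_mx : 'M[R]_(#|G|, #|edge G|) :=
  \matrix_(i, j) (enum_val i \in val (enum_val j : edge G))%:R.

Lemma sum_enum_val (T : finType) (F : T -> R) : \sum_(i < #|T|) F (enum_val i) = \sum_x F x.
Proof. by rewrite (big_enum_val (A := T)). Qed.

Lemma incidence_mulmx_tr t : regular G t ->
  incidence_mx *m incidence_mx^T = adj_mx R G + t%:R%:M.
Proof.
move=> regG; apply/matrixP => i j; rewrite !mxE.
under eq_bigr do rewrite !mxE -natrM.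
rewrite (sum_enum_val (fun e : edge G =>
  ((enum_val i \in val e) * (enum_val j \in val e))%:R)) -natr_sum.
have [<-|ij] := eqVneq i j.
  rewrite adj_irrefl add0r -(regG (enum_val i)) -sum_edges_at.
  by congr _%:R; apply: eq_bigr => e _; case: (_ \in _).
by rewrite sum_edges_between ?addr0 // (inj_eq enum_val_inj).
Qed.

Lemma incidence_tr_mulmx :
  incidence_mx^T *m incidence_mx = 2%:M + \matrix_(i, j)
    ((enum_val i != enum_val j) && (val (enum_val i : edge G) :&: val (enum_val j) != set0))%:R.
Proof.
apply/matrixP => i j; rewrite !mxE.
under eq_bigr do rewrite !mxE -natrM.
rewrite (sum_enum_val (fun x : G =>
  ((x \in val (enum_val i : edge G)) * (x \in val (enum_val j : edge G)))%:R)) -natr_sum edge_capE.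
by rewrite natrD natrM mulr_natr (inj_eq enum_val_inj).
Qed.

Lemma Aalpha_regular (alpha : R) t : regular G t ->
  Aalpha G alpha = (alpha * t%:R)%:M + (1 - alpha) *: adj_mx R G.
Proof.
move=> regG; congr (_ + _); rewrite -scale_scalar_mx; congr (_ *: _).
by rewrite -diag_const_mx; congr diag_mx; apply/rowP => i; rewrite !mxE regG.
Qed.

Lemma Aalpha_rowsum (alpha : R) t i : regular G t -> \sum_j Aalpha G alpha i j = t%:R.
Proof.
move=> regG; rewrite (Aalpha_regular _ regG).
under eq_bigr do rewrite !mxE.
rewrite big_split -mulr_sumr /= (sum_enum_val (fun y => (adj (enum_val i) y)%:R)) -natr_sum.
rewrite -degreeE regG (bigD1 i) //= eqxx big1 ?addr0; last first.
  by move=> j; rewrite eq_sym => /negPf->.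
by rewrite mulr1n -mulrDl addrC subrK mul1r.
Qed.

Lemma Aalpha_sym (alpha : R) : (Aalpha G alpha)^T = Aalpha G alpha.
Proof.
rewrite /Aalpha linearD !linearZ /= tr_diag_mx; congr (_ + _ *: _).
by apply/matrixP => i j; rewrite !mxE adj_sym.
Qed.

End Blocks.

Lemma Aalpha_ge0 (R : realDomainType) (G : sgraph) (alpha : R) i j :
  0 <= alpha <= 1 -> 0 <= Aalpha G alpha i j.
Proof.
move=> /andP[a0 a1]; rewrite !mxE addr_ge0 // mulr_ge0 ?subr_ge0 //.
by rewrite mulrn_wge0.
Qed.

(** The degrees in the join are [2 * t + #|G2|], [2 * t], and the old degree plus [#|G1|]. In the
    first block one [a * t] is absorbed into [Aalpha G1 alpha]; in the edge block the diagonal 2 of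
    the Gram matrix accounts for the shift [2 - 2 * a]. *)
Lemma phi_join_block (R : rcfType) (alpha : R) (G1 G2 : sgraph) (t : nat) :
  regular G1 t ->
  let nu := ratX R in
  let a := ratC alpha in
  let N := map_mx (@ratC R) (incidence_mx R G1) in
  phi (Aalpha (tvertex_join G1 G2) alpha) nu =
  \det (block_mx ((nu - a * t%:R - a * #|G2|%:R)%:M - map_mx (@ratC R) (Aalpha G1 alpha))
         (row_mx (- (1 - a) *: N) (const_mx (- (1 - a))))
         (col_mx (- (1 - a) *: N^T) (const_mx (- (1 - a))))
         (block_mx ((nu + 2 - 2 * a - 2 * a * t%:R)%:M - (1 - a) *: (N^T *m N)) 0 0
            (shifted_mx (Aalpha G2 alpha) (nu - a * #|G1|%:R)))).
Proof.
move=> regG nu a N; set T := tvertex_join G1 G2.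
pose f (u v : T) := nu *+ (u == v)
  - (a * ((degree u)%:R *+ (u == v)) + (1 - a) * (adj u v)%:R).
rewrite /phi; have -> : shifted_mx (Aalpha T alpha) nu
    = \matrix_(i, j) f (enum_val i) (enum_val j).
  apply/matrixP => i j; rewrite !mxE /f (inj_eq enum_val_inj); congr (_ - _).
  by rewrite !ratCE.
rewrite -(det_reindex f (join_index_bij G1 G2)); congr (\det _).
apply/matrixP => i j; rewrite [LHS]mxE /f (inj_eq (bij_inj (join_index_bij G1 G2))) {f}.
case: (split_ordP i) => [x|i'] ->; case: (split_ordP j) => [y|j'] ->;
  rewrite ?eq_lshift ?eq_rshift ?eq_lrshift ?eq_rlshift.
- rewrite block_mxEul !join_indexE /= degree_join_left degree_total_vertex !mxE regG.
  rewrite !ratCE -/a /= natrD natrM mul1n.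
  by case: (x == y); rewrite ?mulr1n ?mulr0n; ring.
- rewrite block_mxEur !mulr0n mulr0 !add0r mxE.
  by case: (split_ordP j') => [e|y] ->; rewrite !join_indexE !mxE /= ?ratCE ?mulr1 ?mulNr.
- rewrite block_mxEdl !mulr0n mulr0 !add0r mxE.
  by case: (split_ordP i') => [e|x] ->; rewrite !join_indexE !mxE /= ?ratCE ?mulr1 ?mulNr.
have NtN : N^T *m N = map_mx (@ratC R) ((incidence_mx R G1)^T *m incidence_mx R G1).
  by rewrite map_mxM map_trmx.
rewrite block_mxEdr NtN incidence_tr_mulmx.
case: (split_ordP i') => [e|x] ->; case: (split_ordP j') => [f|y] ->;
  rewrite ?eq_lshift ?eq_rshift ?eq_lrshift ?eq_rlshift !join_indexE /=.
- rewrite block_mxEul degree_join_left (degree_total_edge _ regG) !mxE.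
  rewrite !ratCE -/a /= addn0 natrM.
  by case: (e == f); rewrite ?mulr1n ?mulr0n; ring.
- by rewrite block_mxEur !mxE !mulr0n !mulr0 !addr0 subr0.
- by rewrite block_mxEdl !mxE !mulr0n !mulr0 !addr0 subr0.
rewrite block_mxEdr degree_join_right !mxE.
rewrite !ratCE -/a /= natrD.
by case: (x == y); rewrite ?mulr1n ?mulr0n; ring.
Qed.

(** * Assembly of the factorization over the rational functions *)

Theorem theorem5p1 (R : rcfType) (alpha : R) (G1 G2 : sgraph)
    (t1 n1 m1 n2 : nat) :
  0 <= alpha <= 1 ->
  (0 < n1)%N ->
  #|G1| = n1 -> #|edge_set G1| = m1 -> regular G1 t1 ->
  #|G2| = n2 ->
  let nu := ratX R in
  let a := ratC alpha in
  let lam := fun i : nat => ratC (lambda (Aalpha G1 alpha) i) in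
  let nu2 := nu - a * n1%:R in
  phi (Aalpha (tvertex_join G1 G2) alpha) nu =
    (nu + 2 - 2 * a - 2 * a * t1%:R) ^ (m1%:Z - n1%:Z)
    * phi (Aalpha G2 alpha) nu2
    * (\prod_(2 <= i < n1.+1)
         (nu ^+ 2
          + (2 - t1%:R - 2 * a - a * t1%:R - a * n2%:R - 2 * lam i) * nu
          - (1 - a) * (t1%:R - 2 * a * t1%:R + lam i)
          + (a * t1%:R + a * n2%:R + lam i) * (t1%:R - 2 + 2 * a + lam i)))
    * ((nu - t1%:R - a * t1%:R - a * n2%:R) * (nu + 2 - 2 * a - 2 * t1%:R)
       - 2 * t1%:R * (1 - a) ^+ 2
       - n1%:R * (1 - a) ^+ 2 * (nu + 2 - 2 * a - 2 * t1%:R)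
         * coronal (Aalpha G2 alpha) nu2).
Proof.
move=> alpha01 n1_gt0 cardG1 cardE1 regG cardG2 nu a lam nu2.
have cardE : #|edge G1| = m1 by rewrite card_sig.
subst n1 n2 m1; rewrite -cardE; set n1 := #|G1| in n1_gt0 nu2 *.
pose t : ratfun R := t1%:R; pose w := nu + 2 - 2 * a - 2 * a * t.
(* [r] is chosen so that [b *: (N *m N^T) = M + r%:M]: for a [t]-regular graph [(1 - a)(A + t)]
   equals [M - a t + (1 - a) t]. *)
pose p := nu - a * t - a * #|G2|%:R; pose r := t - 2 * a * t; pose b := 1 - a.
pose M := map_mx (@ratC R) (Aalpha G1 alpha).
pose N := map_mx (@ratC R) (incidence_mx R G1).
pose x (l : ratfun R) := (w - r - l) * (p - l) - b * (l + r).
pose E := shifted_mx (Aalpha G2 alpha) nu2.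
have M1 : M *m (const_mx 1 : 'cV_n1) = t *: const_mx 1.
  apply/colP => i; rewrite !mxE mulr1.
  under eq_bigr do rewrite !mxE mulr1.
  have := congr1 (@ratC R) (Aalpha_rowsum alpha i regG); rewrite rmorph_sum ratCE -/t => <-.
  by apply: eq_bigr => j _; rewrite !mxE.
have NNt : b *: (N *m N^T) = M + r%:M.
  rewrite /N map_trmx -map_mxM (incidence_mulmx_tr _ regG) /M (Aalpha_regular _ regG).
  apply/matrixP => i j; rewrite !mxE !ratCE -/a -/b -/t.
  by case: (i == j); rewrite ?mulr1n ?mulr0n /b /r; ring.
have wE : w = nu - ratC (2 * alpha + 2 * alpha * t1%:R - 2).
  by rewrite !ratCE -/a /w -/t; ring.
have w0 : w != 0 by rewrite wE ratXsubC_neq0.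
have Du : w%:M - b *: (N^T *m N) \in unitmx.
  rewrite /N map_trmx -map_mxM wE.
  have -> : b = ratC (1 - alpha) by rewrite !ratCE.
  by rewrite -map_mxZ; apply: shifted_mx_unit.
have Eu : E \in unitmx.
  have nu2E : nu2 = nu - ratC (alpha * n1%:R) by rewrite !ratCE.
  by rewrite /E nu2E shifted_mx_unit.
(* The factor at the eigenvalue [t] must be nonzero both for [det_sub_ones] and for the cancellation
   that follows. *)
have xt0 : x t != 0.
  have -> : x t = (nu - ratC (2 * alpha + 2 * t1%:R - 2))
      * (nu - ratC (alpha * t1%:R + alpha * #|G2|%:R + t1%:R))
      - ratC ((1 - alpha) * (2 * t1%:R - 2 * alpha * t1%:R)).
    by rewrite !ratCE -/a -/t /x /w /p /r /b; ring.
  exact: ratX_quadratic_neq0.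
have [U Uu [d eqd]] := sym_diagonalizable (Aalpha_sym G1 alpha).
have eigs := eigvals_split (char_poly_similar_diag Uu eqd).
(* Here [alpha01] enters: nonnegative entries make [t1] the largest eigenvalue, so the factor split
   off is the one at index 1. *)
have lam1 : lambda (Aalpha G1 alpha) 1 = t1%:R.
  have [i di] := rowsum_eigenvalue n1_gt0 Uu eqd (fun i => Aalpha_rowsum alpha i regG).
  apply: (lambda1_max eigs); first by rewrite -di; apply: image_f.
  move=> _ /imageP[j _ ->]; apply: rowsum_eigenvalue_le Uu eqd (Aalpha_sym _ _) _ _.
    by move=> i' j'; apply: Aalpha_ge0.
  by move=> k; apply: Aalpha_rowsum.
pose Q := ((w - r)%:M - M) *m (p%:M - M) - b *: (M + r%:M).
have detQ : \det Q = x t * \prod_(2 <= i < n1.+1) x (lam i).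
  have UuK : map_mx (@ratC R) U \in unitmx by rewrite map_unitmx.
  have eqK : map_mx (@ratC R) U *m M = diag_mx (map_mx (@ratC R) d) *m map_mx (@ratC R) U.
    by rewrite -map_mxM eqd map_mxM map_diag_mx.
  rewrite (det_quadratic_mx b p r w UuK eqK).
  have := lambda_prod (fun l => x (ratC l)) n1_gt0 eigs.
  rewrite lam1 ratCE => <-; last by rewrite size_image card_ord.
  by rewrite big_image; apply: eq_bigr => i _; rewrite mxE.
have Q1 : Q *m (const_mx 1 : 'cV_n1) = x t *: const_mx 1.
  have SM1 c : (c%:M - M) *m (const_mx 1 : 'cV_n1) = (c - t) *: const_mx 1.
    by rewrite mulmxBl M1 mul_scalar_mx -scalerBl.
  rewrite /Q mulmxBl -mulmxA SM1 -scalemxAr SM1 -scalemxAl mulmxDl M1 mul_scalar_mx.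
  by rewrite -scalerDl !scalerA -scalerBl [_ * (w - r - t)]mulrC.
have := det_join_block p NNt M1 Du Eu; rewrite -/Q -(phi_join_block _ _ regG).
set c := b ^+ 2 * _ * _ => phiE.
(* Subtracting the constant matrix alters only the factor belonging to the all-ones eigenvector,
   turning [x t] into [x t - c * n1%:R]. *)
have detc : \det (Q - const_mx c) = \prod_(2 <= i < n1.+1) x (lam i) * (x t - c * n1%:R).
  by apply: (mulfI xt0); rewrite (det_sub_ones c xt0 Q1) detQ mulrA.
(* Since [w] is nonzero, its two natural powers combine into one integer power, possibly
   negative. *)
rewrite detc -[RHS]mulrA in phiE; rewrite (eq_expfz_sub w0 phiE).
rewrite -[RHS]mulrA -[RHS]mulrA; congr (_ * (_ * (_ * _))).
  by apply: eq_bigr => i _; rewrite /x /w /p /r /b; ring.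
have -> : c = b ^+ 2 * coronal (Aalpha G2 alpha) nu2 * (w - r - t) by [].
by rewrite /x /w /p /r /b; ring.
Qed.
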